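(* Let $a\in\mathbb{Z}_{\ge0}^n$ be a weak composition all of whose nonzero entries are equal (equivalently $a=w\lambda$ where $\lambda=s^r$ is a rectangle and $w\in S_n^\lambda$). Then $$\overline{L}_{a}(\mathbf{x};\beta)=\sum_{S\in\mathrm{Sky}_{a}}\mathrm{wt}_\beta(S).$$
   Context: $S_n$ is generated by simple transpositions $s_1,\dots,s_{n-1}$ and acts on $\mathbb{Z}^n$ by $(wa)_j=a_{w^{-1}(j)}$. For a partition $\lambda$ (as a vector in $\mathbb{Z}^n$), $S_n^\lambda$ is the set of minimal-length coset representatives of $S_n/\mathrm{Stab}(\lambda)$. On $\mathbb{Z}[\beta][x_1,\dots,x_n]$ define $\pi_if=\frac{x_if-x_{i+1}\,s_if}{x_i-x_{i+1}}$, $\varpi_if=\pi_i((1+\beta x_{i+1})f)$ and $\overline{\varpi}_i=\varpi_i-1$; these satisfy the braid relations, so for a reduced expression $w=s_{i_1}\cdots s_{i_\ell}$ the product $\overline{\varpi}_w=\overline{\varpi}_{i_1}\cdots\overline{\varpi}_{i_\ell}$ is well defined. The Lascoux atom is $\overline{L}_{w\lambda}(\mathbf{x};\beta):=\overline{\varpi}_w\,x_1^{\lambda_1}\cdots x_n^{\lambda_n}$ for $w\in S_n^\lambda$. Set-valued skyline tableaux: the skyline diagram of $a$ has boxes at $(i,y)$ for $1\le i\le n$, $1\le y\le a_i$ (column $i$, row $y$, row 1 at the bottom; ''below'' means smaller $y$). Fill each box with a nonempty finite set of positive integers; the largest entry of a box is its anchor, the other entries are free. Conditions: (S.1) entries do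 not repeat within a row; (S.2) if box $B$ is directly below box $A$ then $\min B\ge\max A$; (S.3) for every triple consisting of boxes $C=(j,y)$, $A=(i,y)$, $B=(i,y-1)$ with $j<i$ and $a_j\le a_i$, and for every triple consisting of boxes $A=(j,y)$, $B=(j,y-1)$, $C=(i,y)$ with $j<i$ and $a_j>a_i$, the anchors $\alpha,\beta',\gamma$ of $A,B,C$ satisfy $\gamma<\alpha$ or $\beta'<\gamma$; (S.4) every free entry lies in the leftmost box of its row in which it can be placed without violating (S.2); (S.5) the anchor of each box in row $1$ equals its column index. $\mathrm{Sky}_a$ is the set of such fillings. For $S$ such a filling, $\mathrm{wt}_\beta(S)=\beta^{e}\prod_ix_i^{c_i}$ where $c_i$ is the number of boxes containing $i$ and $e=\sum_{\text{boxes }A}(|A|-1)$. *)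

(* Defs.v *)
From HB Require Import structures.
From mathcomp Require Import all_boot all_order all_fingroup all_algebra.
From mathcomp Require Import mpoly.

Set Implicit Arguments.
Unset Strict Implicit.
Unset Printing Implicit Defensive.

Import GRing.Theory.

(* Everything is 0-based: the simple transpositions s_1, ..., s_{n-1}, the
   variables, the columns, the rows and the tableau entries 1, 2, ... are all
   shifted down by one. *)

Section SymmetricGroup.
Variable n : nat.

Lemma ord_hi_subproof (i : 'I_n.-1) : i.+1 < n.
Proof. by rewrite -ltn_predRL. Qed.

Definition lo (i : 'I_n.-1) : 'I_n := widen_ord (leq_pred n) i.
Definition hi (i : 'I_n.-1) : 'I_n := Ordinal (ord_hi_subproof i).

Definition simple_tr (i : 'I_n.-1) : 'S_n := tperm (lo i) (hi i).

(* (u * v)%g applies u first, so s_i o u is (u * s_i)%g: the word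
   [:: i1; ...; il] denotes the composite s_i1 o ... o s_il. *)
Definition word_perm (ws : seq 'I_n.-1) : 'S_n :=
  foldr (fun i u => (u * simple_tr i)%g) 1%g ws.

Lemma word_perm_cat us ws :
  word_perm (us ++ ws) = (word_perm ws * word_perm us)%g.
Proof. by elim: us => [|i us IH] /=; rewrite ?mulg1 // IH mulgA. Qed.

Lemma word_tperm_lt (i j : 'I_n) : i < j -> exists ws, word_perm ws == tperm i j.
Proof.
case: j => j jn /=; elim: j jn => // j IH jn; rewrite ltnS leq_eqVlt.
have jn' : j < n.-1 by rewrite ltn_predRL.
pose k : 'I_n.-1 := Ordinal jn'; pose j0 : 'I_n := Ordinal (ltnW jn).
have lok : lo k = j0 by apply: val_inj.
have hik : hi k = Ordinal jn by apply: val_inj.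
case/orP => [/eqP ij | ij].
  exists [:: k]; rewrite /= mul1g /simple_tr lok hik.
  by have -> : i = j0 by apply: val_inj.
have [ws /eqP Hws] := IH (ltnW jn) ij.
exists (k :: ws ++ [:: k]).
rewrite /= word_perm_cat Hws /= mul1g /simple_tr lok hik.
have := tpermJ i (Ordinal (ltnW jn)) (tperm j0 (Ordinal jn)).
rewrite (tpermD (z := i)); last 2 first.
- by rewrite -val_eqE /= gtn_eqF.
- by rewrite -val_eqE /= gtn_eqF // ltnS ltnW.
rewrite tpermL => <-.
by rewrite conjgE tpermV mulgA.
Qed.

Lemma word_exists (w : 'S_n) : exists ws, word_perm ws == w.
Proof.
case: (prod_tpermP w) => ts -> _; elim: ts => [|[x y] ts [ws /eqP IH]].
  by exists [::]; rewrite big_nil.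
rewrite big_cons /=.
suff [us /eqP Hus] : exists us, word_perm us == tperm x y.
  by exists (ws ++ us); rewrite word_perm_cat IH Hus.
case: (ltngtP x y) => [xy|yx|/val_inj ->].
- exact: word_tperm_lt.
- by rewrite tpermC; apply: word_tperm_lt.
- by exists [::]; rewrite tperm1.
Qed.

Lemma word_size_exists (w : 'S_n) :
  exists l, [exists t : l.-tuple 'I_n.-1, word_perm t == w].
Proof.
have [ws Hws] := word_exists w.
by exists (size ws); apply/existsP; exists (in_tuple ws).
Qed.

Definition perm_length (w : 'S_n) : nat := ex_minn (word_size_exists w).

Definition reduced_word (w : 'S_n) (ws : seq 'I_n.-1) : Prop :=
  word_perm ws = w /\ size ws = perm_length w.

Definition act_comp (w : 'S_n) (a : 'X_{1..n}) : 'X_{1..n} :=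
  [multinom a ((w^-1)%g j) | j < n].

Definition is_partition (lam : 'X_{1..n}) : Prop :=
  forall i j : 'I_n, i <= j -> lam j <= lam i.

(* w belongs to S_n^lam: it is shortest among the elements w o u of its coset *)
Definition min_coset_rep (lam : 'X_{1..n}) (w : 'S_n) : Prop :=
  forall u : 'S_n, act_comp u lam = lam -> perm_length w <= perm_length (u * w)%g.

End SymmetricGroup.

Section Skyline.
Variable n : nat.
Implicit Type a : 'X_{1..n}.

Definition height a : nat := \max_(i < n) a i.

Definition cell a : finType := ('I_n * 'I_(height a))%type.

Definition in_diagram a (b : cell a) : bool := b.2 < a b.1.

(* Entries are taken in {1..n} rather than among all positive integers: skyS2
   and skyS5 below force every entry of column i to be at most i.  A filling takes
   the value set0 off the diagram. *)
Definition filling a : finType := {ffun cell a -> {set 'I_n}}.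

Definition anchor (A : {set 'I_n}) : nat := \max_(e in A) e.

Section Conditions.
Variable a : 'X_{1..n}.
Implicit Type F : filling a.

Definition skyS0 F : bool := [forall b : cell a, (F b != set0) == in_diagram b].

Definition skyS1 F : bool :=
  [forall y : 'I_(height a), forall i : 'I_n, forall j : 'I_n,
    (i != j) ==> [disjoint F (i, y) & F (j, y)]].

Definition skyS2 F : bool :=
  [forall i : 'I_n, forall y : 'I_(height a), forall y' : 'I_(height a),
    ((y == y'.+1 :> nat) && in_diagram (i, y)) ==>
    [forall x in F (i, y), forall z in F (i, y'), x <= z]].

Definition triple_ok F (A B C : cell a) : bool :=
  (anchor (F C) < anchor (F A)) || (anchor (F B) < anchor (F C)).

Definition skyS3 F : bool :=
  [forall j : 'I_n, forall i : 'I_n,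
   forall y : 'I_(height a), forall y' : 'I_(height a),
    ((j < i) && (y == y'.+1 :> nat)) ==>
      (([&& a j <= a i, in_diagram (j, y) & in_diagram (i, y)]
          ==> triple_ok F (i, y) (i, y') (j, y))
    && ([&& a i < a j, in_diagram (j, y) & in_diagram (i, y')]
          ==> triple_ok F (j, y) (j, y') (i, y')))].

Definition add_entry F (x : 'I_n) (b : cell a) : filling a :=
  [ffun c => if c == b then x |: F c else F c].

(* x can be placed in b as a free entry, hence without becoming its anchor.
   Taking x out of its own box, which lies in another column, cannot affect
   whether skyS2 holds after the insertion. *)
Definition can_be_free F (x : 'I_n) (b : cell a) : bool :=
  [&& in_diagram b, x < anchor (F b) & skyS2 (add_entry F x b)].

Definition skyS4 F : bool :=
  [forall i : 'I_n, forall y : 'I_(height a), forall x in F (i, y),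
    (x != anchor (F (i, y)) :> nat) ==>
    [forall j : 'I_n, (j < i) ==> ~~ can_be_free F x (j, y)]].

Definition skyS5 F : bool :=
  [forall i : 'I_n, forall y : 'I_(height a),
    ((y == 0 :> nat) && in_diagram (i, y)) ==> (anchor (F (i, y)) == i)].

End Conditions.

Definition Sky a : {set filling a} :=
  [set F | [&& skyS0 F, skyS1 F, skyS2 F, skyS3 F, skyS4 F & skyS5 F]].

End Skyline.

Local Open Scope ring_scope.

Definition beta : {poly int} := 'X.

Section Operators.
Variable n : nat.
Local Notation P := {mpoly {poly int}[n]}.

Definition demazure_num (i : 'I_n.-1) (f : P) : P :=
  'X_(lo i) * f - 'X_(hi i) * msym (simple_tr i) f.

Lemma msym_sub_dvd (i : 'I_n.-1) (f : P) :
  exists q : P, q * ('X_(lo i) - 'X_(hi i)) = f - msym (simple_tr i) f.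
Proof.
set d := 'X_(lo i) - 'X_(hi i); set s := simple_tr i.
pose D (g : P) := exists q : P, q * d = g - msym s g.
have D1 : D 1 by exists 0; rewrite msym1 subrr mul0r.
have DD g h : D g -> D h -> D (g + h).
  by move=> [q Hq] [r Hr]; exists (q + r); rewrite mulrDl Hq Hr msymD opprD addrACA.
have DM g h : D g -> D h -> D (g * h).
  move=> [q Hq] [r Hr]; exists (g * r + q * msym s h).
  rewrite mulrDl -mulrA Hr mulrAC Hq msymM mulrBr mulrBl.
  by rewrite addrA subrK.
have DZ c g : D g -> D (c *: g).
  by move=> [q Hq]; exists (c *: q); rewrite -scalerAl Hq msymZ scalerBr.
have DX k : D 'X_k.
  have HX : msym s ('X_k : P) = 'X_(s k).
    rewrite msymX; congr 'X_[_]; apply/mnmP => j.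
    by rewrite !mnmE -(inj_eq (@perm_inj _ s)) permKV.
  rewrite /D HX.
  rewrite /s /simple_tr; case: tpermP => [->|->|_ _].
  - by exists 1; rewrite mul1r.
  - by exists (-1); rewrite mulN1r opprB.
  - by exists 0; rewrite mul0r subrr.
suff DXm m : D 'X_[m].
  elim/mpolyind: f => [|c m g _ _ IH]; first by exists 0; rewrite msym0 subrr mul0r.
  by apply: DD IH; apply: DZ; apply: DXm.
rewrite mpolyXE_id.
apply: (big_ind D) => [||k _]; [exact: D1 | exact: DM |].
elim: (m k) => [|l IH]; first by rewrite expr0; exact: D1.
by rewrite exprS; apply: DM; [exact: DX | exact: IH].
Qed.

Lemma demazure_dvd (i : 'I_n.-1) (f : P) :
  exists q : P, q * ('X_(lo i) - 'X_(hi i)) == demazure_num i f.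
Proof.
have [q Hq] := msym_sub_dvd i f.
exists (f + 'X_(hi i) * q); rewrite mulrDl -mulrA Hq /demazure_num.
by rewrite mulrBr mulrBr (mulrC f) (mulrC f) addrA subrK.
Qed.

(* pi_i f is the quotient demazure_num i f / (x_i - x_{i+1}), which is unique
   since {mpoly {poly int}[n]} is an integral domain. *)
Definition demazure (i : 'I_n.-1) (f : P) : P := xchoose (demazure_dvd i f).

Lemma demazureE (i : 'I_n.-1) (f : P) :
  demazure i f * ('X_(lo i) - 'X_(hi i)) = demazure_num i f.
Proof. exact/eqP/(xchooseP (demazure_dvd i f)). Qed.

Definition varpi (i : 'I_n.-1) (f : P) : P :=
  demazure i ((1 + beta *: 'X_(hi i)) * f).

Definition varpibar (i : 'I_n.-1) (f : P) : P := varpi i f - f.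

Definition varpibar_word (ws : seq 'I_n.-1) (f : P) : P := foldr varpibar f ws.

(* The Lascoux atom of w lam, computed along a reduced word ws of w;
   by the braid relations it does not depend on ws. *)
Definition lascoux_atom (ws : seq 'I_n.-1) (lam : 'X_{1..n}) : P :=
  varpibar_word ws 'X_[lam].

Definition sky_content (a : 'X_{1..n}) (F : filling a) : 'X_{1..n} :=
  [multinom #|[set b : cell a | k \in F b]| | k < n].

Definition sky_excess (a : 'X_{1..n}) (F : filling a) : nat :=
  (\sum_(b : cell a | in_diagram b) #|F b|.-1)%N.

Definition wt_beta (a : 'X_{1..n}) (F : filling a) : P :=
  beta ^+ sky_excess F *: 'X_[sky_content F].

End Operators.

(* Main.v *)
Require Import Defs.
From mathcomp Require Import all_boot all_order all_fingroup all_algebra.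
From mathcomp Require Import mpoly.
From mathcomp Require Import ring zify.

(* Let c be the set of the r nonempty columns, all of height h, and for a set A
   let rk A k be the number of elements of A below k.  In a skyline tableau of
   this shape the anchors increase from left to right in every row, so a row is
   determined by its set B of anchors and its set E of free entries: an entry x
   lies in the column whose rank in c is rk B x.  If A is the anchor set of the
   next row ({1, ..., r} above the top row), the conditions say exactly that
   #|A| = #|B|, that rk B <= rk A, and that E is any set of elements
   k of the complement of B with rk B (k+1) < rk A (k+1).  Hence the sum over
   tableaux is obtained by iterating h times the transfer matrix
     T(B, A) = prod_(k in B) x_k * prod_k (1 + beta x_k),
   the second product running over the possible free entries.
   On the operator side, varpibar_i = x_(i+1) (1 + beta x_i) d_i with d_i the
   divided difference, and w has the length of a path raising {1, ..., r} to c
   by steps that replace some i by i+1.  It remains to see that varpibar_i maps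
   the iterate at c to the iterate at s_i c when i is in c and i+1 is not;
   by induction on h this is an identity for each s_i-orbit of sets A, where
   all but the factors of T at i and i+1 are symmetric. *)

Set Implicit Arguments.
Unset Strict Implicit.
Unset Printing Implicit Defensive.

Import GRing.Theory.

(** * Initial sets and rank functions of subsets *)

Definition init_set n r : {set 'I_n} := [set k : 'I_n | k < r].

Section Rank.
Variable n : nat.
Implicit Types (A : {set 'I_n}) (e f : 'I_n).

Definition rk A (k : nat) : nat := #|[set e in A | e < k]|.

Lemma rkS A e : rk A e.+1 = rk A e + (e \in A).
Proof.
rewrite /rk; have [eA|eNA] := boolP (e \in A).
  rewrite (cardsD1 e) !inE eA ltnSn addnC /=; congr (_ + _).
  apply: eq_card => k; rewrite !inE ltnS leq_eqVlt -val_eqE /=.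
  by case: ltngtP; rewrite ?andbF ?andbT //=.
rewrite addn0; apply: eq_card => k; rewrite !inE ltnS leq_eqVlt val_eqE.
by case: eqVneq => [->|]; rewrite ?(negPf eNA).
Qed.

Lemma rk_mono A k l : k <= l -> rk A k <= rk A l.
Proof.
move=> kl; apply/subset_leq_card/subsetP => e; rewrite !inE.
by case/andP => -> /leq_trans; apply.
Qed.

Lemma rk_lt A e k : e \in A -> e < k -> rk A e < rk A k.
Proof. by move=> eA /(rk_mono A); rewrite rkS eA addn1. Qed.

Lemma rk_inj A : {in A &, injective (fun e => rk A e)}.
Proof.
move=> e f eA fA ef; apply/val_inj; case: (ltngtP e f) => //.
  by move/(rk_lt eA); rewrite ef ltnn.
by move/(rk_lt fA); rewrite ef ltnn.
Qed.

Lemma rk_max A : rk A n = #|A|.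
Proof. by apply: eq_card => e; rewrite inE ltn_ord andbT. Qed.

Lemma rk_le_card A k : rk A k <= #|A|.
Proof. by apply/subset_leq_card/subsetP => e; rewrite inE; case/andP. Qed.

Lemma rk_le_id A k : rk A k <= k.
Proof.
elim: k => [|k IH]; first by rewrite leqn0 cards_eq0; apply/eqP/setP => e; rewrite !inE ltn0 andbF.
have [kn|nk] := ltnP k n.
  by rewrite (rkS A (Ordinal kn)) /=; case: (_ \in A); lia.
rewrite -(leq_add2r 1) !addn1 (leq_trans (n := k.+1)) // ltnS.
apply: leq_trans IH; apply/subset_leq_card/subsetP => e; rewrite !inE => /andP[->] _.
exact: leq_trans (ltn_ord e) nk.
Qed.

(** The rank starts at 0, ends at [#|A|] and grows by at most one at a time, each increase occurring
    at an element of [A]. *)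
Lemma rk_surj A m : m < #|A| -> exists2 e, e \in A & rk A e = m.
Proof.
rewrite -rk_max.
suff H k : k <= n -> m < rk A k -> exists2 e, e \in A & rk A e = m by apply: H.
elim: k => [_|k IH kn].
  by move/leq_trans/(_ (rk_le_id A 0)).
have [lt_m _|le_m] := ltnP m (rk A k); first exact: IH (ltnW kn) lt_m.
rewrite (rkS A (Ordinal kn)) /=.
case: (boolP (_ \in A)) => kA lt_m; last by lia.
by exists (Ordinal kn) => //=; lia.
Qed.

Lemma rk_init r k : k <= n -> rk (init_set n r) k = minn r k.
Proof.
elim: k => [_|k IH kn].
  by apply/eqP; rewrite minn0 -leqn0 rk_le_id.
rewrite (rkS _ (Ordinal kn)) inE /= IH; last exact: ltnW.
by case: ltnP; lia.
Qed.

Lemma down_closed_init A :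
  (forall e f : 'I_n, e <= f -> f \in A -> e \in A) -> A = init_set n #|A|.
Proof.
move=> downA; apply/eqP; rewrite eqEcard -[X in _ && (X <= _)]rk_max rk_init // geq_minl andbT.
apply/subsetP => e eA; rewrite inE -rk_max.
apply: leq_trans (rk_lt eA (ltn_ord e)).
rewrite ltnS; have: forall k, k <= e -> k <= rk A k; last by apply.
elim=> // k IH ke; have kn := ltn_trans ke (ltn_ord e).
have:= rkS A (Ordinal kn); rewrite /= (downA _ e) //=; last exact: ltnW.
by have := IH (ltnW ke); lia.
Qed.

End Rank.

Local Open Scope ring_scope.

(** * Divided differences and the operators [varpibar] *)

Section DividedDifference.
Variables (n : nat) (i : 'I_n.-1).
Local Notation P := {mpoly {poly int}[n]}.
Local Notation s := (simple_tr i).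
Local Notation x := ('X_(lo i) : P).
Local Notation y := ('X_(hi i) : P).
Local Notation b := (beta%:MP_[n] : P).
Implicit Types f g : P.

(* Kept opaque so that unification does not compare the quotients themselves. *)
Lemma dd_exists f : {q : P | q * (x - y) = f - msym s f}.
Proof.
have ex_q : exists q : P, q * (x - y) == f - msym s f.
  by have [q Hq] := msym_sub_dvd i f; exists q; apply/eqP.
by exists (xchoose ex_q); apply/eqP/(xchooseP ex_q).
Qed.

Definition dd f : P := sval (dd_exists f).

Lemma ddE f : dd f * (x - y) = f - msym s f.
Proof. exact: svalP (dd_exists f). Qed.

Lemma lo_neq_hi : lo i != hi i.
Proof. by rewrite -val_eqE /= neq_ltn ltnSn. Qed.

Lemma msym_var (t : 'S_n) (k : 'I_n) : msym t 'X_k = 'X_(t k) :> P.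
Proof.
rewrite msymX; congr 'X_[_]; apply/mnmP => j.
by rewrite !mnmE -(inj_eq (@perm_inj _ t)) permKV.
Qed.

Lemma msym_const (t : 'S_n) c : msym t (c%:MP_[n]) = c%:MP_[n] :> P.
Proof. by rewrite -[c%:MP]mulr1 mul_mpolyC msymZ msym1. Qed.

Lemma msym_lo : msym s x = y. Proof. by rewrite msym_var tpermL. Qed.
Lemma msym_hi : msym s y = x. Proof. by rewrite msym_var tpermR. Qed.

Lemma msymK f : msym s (msym s f) = f.
Proof. by rewrite -msymMm tperm2 msym1m. Qed.

Lemma subX_neq0 : x - y != 0.
Proof.
rewrite subr_eq0; apply/eqP => /mpolyP/(_ U_(lo i)%MM); rewrite !mcoeffX eqxx.
rewrite eq_mnm1 eq_sym (negPf lo_neq_hi) => /eqP.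
by rewrite oner_eq0.
Qed.

Lemma dd_eq f q : f - msym s f = q * (x - y) -> dd f = q.
Proof. by move=> fq; apply/(mulIf subX_neq0); rewrite ddE. Qed.

Lemma msym_dd f : msym s (dd f) = dd f.
Proof.
apply/(mulIf subX_neq0); rewrite ddE.
have := congr1 (msym s) (ddE f).
rewrite msymM !msymB msym_lo msym_hi msymK => H.
by rewrite -(opprB y) mulrN H opprB.
Qed.

Lemma ddD f g : dd (f + g) = dd f + dd g.
Proof. by apply: dd_eq; rewrite [RHS]mulrDl (ddE f) (ddE g) msymD opprD; exact: addrACA. Qed.

Lemma ddMl f g : msym s f = f -> dd (f * g) = f * dd g.
Proof. by move=> sf; apply: dd_eq; rewrite -mulrA ddE msymM sf; exact/esym/mulrBr. Qed.

Lemma dd0 : dd 0 = 0.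
Proof. by apply: dd_eq; rewrite msym0 mul0r; exact: subrr. Qed.

Lemma dd_sum (I : Type) (r : seq I) (Q : pred I) (F : I -> P) :
  dd (\sum_(j <- r | Q j) F j) = \sum_(j <- r | Q j) dd (F j).
Proof. exact: (big_morph dd ddD dd0). Qed.

(** In this form only [dd] remains to be computed, and [dd] is linear over the polynomials fixed by
    [s_i]. *)
Lemma varpibarE f : varpibar i f = y * (1 + b * x) * dd f.
Proof.
apply/(mulIf subX_neq0); rewrite /varpibar mulrBl /varpi demazureE /demazure_num.
rewrite -(mulrA _ (dd _)) ddE -!mul_mpolyC msymM msymD msym1 msymM msym_hi msym_const.
by ring.
Qed.

End DividedDifference.

(** * The transfer matrix and its local factors at a simple transposition *)

Section Transfer.
Variable n : nat.
Local Notation P := {mpoly {poly int}[n]}.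
Local Notation b := (beta%:MP_[n] : P).
Implicit Types (c A : {set 'I_n}) (r h : nat).

(** The weight of one position [k]: [m] tells whether [k] is an anchor, and [p], [q] are the ranks
    just after [k] in this row and in the next. A violated rank inequality gives 0; [1 + b * x]
    offers the choice of a free entry. *)
Definition phi (x : P) (m : bool) (p q : nat) : P :=
  if (q < p)%N then 0 else if m then x else if (p < q)%N then 1 + b * x else 1.

Definition transfer c A : P :=
  (#|A| == #|c|)%:R * \prod_k phi 'X_k (k \in c) (rk c k.+1) (rk A k.+1).

Fixpoint transfer_iter r h c : P :=
  if h is h'.+1 then \sum_A transfer c A * transfer_iter r h' A
  else (c == init_set n r)%:R.

Section Swap.
Variable i : 'I_n.-1.
Local Notation s := (simple_tr i).
Local Notation x := ('X_(lo i) : P).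
Local Notation y := ('X_(hi i) : P).

Definition swap_set A : {set 'I_n} := s @^-1: A.

Lemma swap_setK : involutive swap_set.
Proof. by move=> A; apply/setP => k; rewrite !inE tpermK. Qed.

Lemma lo_swap A : (lo i \in swap_set A) = (hi i \in A).
Proof. by rewrite inE tpermL. Qed.

Lemma hi_swap A : (hi i \in swap_set A) = (lo i \in A).
Proof. by rewrite inE tpermR. Qed.

Lemma mem_swap_other A k : k != lo i -> k != hi i -> (k \in swap_set A) = (k \in A).
Proof. by move=> kl kh; rewrite inE tpermD // eq_sym. Qed.

Lemma card_swap A : #|swap_set A| = #|A|.
Proof. exact/card_preimset/perm_inj. Qed.

(** The exchanged indices are consecutive, so only a threshold between them tells the two sets
    apart. *)
Lemma rk_swap A k : k != (lo i).+1 -> rk (swap_set A) k = rk A k.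
Proof.
move=> ki; rewrite /rk -(card_preimset [set e in A | (e < k)%N] (@perm_inj _ s)).
apply: eq_card => e; rewrite !inE; case: (_ \in A) => //=.
by case: tpermP => [->|->|] //=; move: ki => /=; lia.
Qed.

Definition local_factor p q (b1 b2 e1 e2 : bool) : P :=
  phi x b1 (p + b1) (q + e1) * phi y b2 (p + b1 + b2) (q + e1 + e2).

Definition other_factor c A : P :=
  (#|A| == #|c|)%:R *
    \prod_(k | (k != lo i) && (k != hi i)) phi 'X_k (k \in c) (rk c k.+1) (rk A k.+1).

Lemma transferE c A :
  transfer c A = other_factor c A *
    local_factor (rk c (lo i)) (rk A (lo i))
      (lo i \in c) (hi i \in c) (lo i \in A) (hi i \in A).
Proof.
rewrite /transfer (bigD1 (lo i)) //= (bigD1 (hi i)) /=; last by rewrite eq_sym lo_neq_hi.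
rewrite /local_factor !(rkS _ (hi i)) -!(rkS _ (lo i)) /other_factor.
by ring.
Qed.

Lemma other_factor_swap c A A' :
  A' = A \/ A' = swap_set A -> other_factor (swap_set c) A' = other_factor c A.
Proof.
move=> eA; rewrite /other_factor card_swap.
have -> : #|A'| = #|A| by case: eA => ->; rewrite ?card_swap.
congr (_ * _); apply: eq_bigr => k /andP[kl kh].
rewrite mem_swap_other // rk_swap //.
by congr phi; case: eA => -> //; rewrite rk_swap.
Qed.

Lemma other_factor_swapr c A : other_factor c (swap_set A) = other_factor c A.
Proof.
rewrite -(@other_factor_swap c (swap_set A) (swap_set A)); last by left.
by rewrite (@other_factor_swap c A) //; right.
Qed.

Lemma msym_phi (t : 'S_n) z m p q : msym t (phi z m p q) = phi (msym t z) m p q.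
Proof.
rewrite /phi; case: ifP => _; first by rewrite msym0.
case: ifP => _ //; case: ifP => _; last by rewrite msym1.
by rewrite msymD msymM msym1 msym_const.
Qed.

Lemma msym_other_factor c A : msym s (other_factor c A) = other_factor c A.
Proof.
rewrite /other_factor msymM; congr (_ * _).
  by case: (_ == _); rewrite ?msym0 ?msym1.
rewrite (big_morph (msym s) (@msymM _ _ s) (msym1 _ s)).
apply: eq_bigr => k /andP[kl kh].
by rewrite msym_phi msym_var tpermD // eq_sym.
Qed.

(** The ranks at [lo i] are compared by the factor at the preceding index, which is part of
    [other_factor]. The local identities below may therefore assume [p <= q]. *)
Lemma other_factor_eq0 c A : (rk A (lo i) < rk c (lo i))%N -> other_factor c A = 0.
Proof.
move=> lt_rk; have lo_gt0 : (0 < lo i)%N.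
  by rewrite lt0n; apply: contraL lt_rk => /eqP ->; rewrite -leqNgt (leq_trans (rk_le_id _ _)).
have klt : ((lo i).-1 < n)%N by rewrite (leq_ltn_trans (leq_pred _)).
rewrite /other_factor (bigD1 (Ordinal klt)) /=.
  by rewrite /phi /= prednK // lt_rk mul0r mulr0.
by rewrite -!val_eqE /=; move: lo_gt0 => /=; lia.
Qed.

Lemma dd_local_fixed p q (m e : bool) : (p <= q)%N -> dd i (local_factor p q m m e e) = 0.
Proof.
move=> pq.
apply: dd_eq; rewrite /local_factor !msymM !msym_phi msym_lo msym_hi /phi.
case: m e => [] [] /=; repeat (case: ltnP => ?; try (exfalso; lia)); by ring.
Qed.

Lemma dd_local_raise p q (e : bool) : (p <= q)%N ->
  y * (1 + b * x) * dd i (local_factor p q true false e e) =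
  local_factor p q false true e e.
Proof.
(* The argument of [dd] is 0, [x] or [x * (1 + b * y)], and the last two both have divided
   difference 1. *)
pose D : P := if (p < q + e)%N then 1 else 0.
move=> pq; rewrite (@dd_eq _ _ _ D).
  rewrite /local_factor /phi /D.
  case: e {D} => /=; repeat (case: ltnP => ?; try (exfalso; lia)); by ring.
rewrite /local_factor !msymM !msym_phi msym_lo msym_hi /phi /D.
case: e {D} => /=; repeat (case: ltnP => ?; try (exfalso; lia)); by ring.
Qed.

Lemma msymE_dd (f : P) : msym s f = f - dd i f * (x - y).
Proof. by rewrite ddE; ring. Qed.

(** [G] stands for the iterate at [A], and [y * (1 + b * x) * dd i G] for the one at [swap_set i A].
    The combination is 0 or a symmetric polynomial times [G + y * (1 + b * x) * dd i G] or
    [G + y * dd i G]; these are [varpi i G] and [demazure i G], both symmetric. *)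
Lemma dd_local_orbit_fixed p q (m : bool) (G : P) : (p <= q)%N ->
  dd i (local_factor p q m m true false * G +
        local_factor p q m m false true * (y * (1 + b * x) * dd i G)) = 0.
Proof.
move=> pq.
apply: dd_eq; rewrite /local_factor !msymD !msymM msymD !msymM msym1 msym_const.
rewrite !msym_phi msym_dd msym_lo msym_hi (msymE_dd G) /phi.
case: m => /=; repeat (case: ltnP => ?; try (exfalso; lia)); by ring.
Qed.

Lemma dd_local_orbit_raise p q (G : P) : (p <= q)%N ->
  y * (1 + b * x) *
    dd i (local_factor p q true false true false * G +
          local_factor p q true false false true * (y * (1 + b * x) * dd i G)) =
  local_factor p q false true true false * G +
  local_factor p q false true false true * (y * (1 + b * x) * dd i G).
Proof.
move=> pq.
(* For [p < q] the argument of [dd] is [x * (1 + b * y)] times the symmetric [varpi i G]; for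
   [p = q] it is [x * G], whose divided difference is [demazure i G]. *)
pose D : P := if (p < q)%N then G + y * (1 + b * x) * dd i G else G + y * dd i G.
rewrite (@dd_eq _ _ _ D).
  rewrite /local_factor /phi /D.
  repeat (case: ltnP => ?; try (exfalso; lia)); by ring.
rewrite /local_factor !msymD !msymM msymD !msymM msym1 msym_const.
rewrite !msym_phi msym_dd msym_lo msym_hi (msymE_dd G) /phi /D.
repeat (case: ltnP => ?; try (exfalso; lia)); by ring.
Qed.

End Swap.
End Transfer.

(** * The action of [varpibar i] on the iterates *)

Section Step.
Variables (n : nat) (i : 'I_n.-1).
Local Notation P := {mpoly {poly int}[n]}.
Local Notation b := (beta%:MP_[n] : P).
Local Notation x := ('X_(lo i) : P).
Local Notation y := ('X_(hi i) : P).
Implicit Types (c A : {set 'I_n}) (r h : nat).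

Lemma sum_swap_orbits (f : {set 'I_n} -> P) :
  \sum_A f A = \sum_(A : {set 'I_n} | (lo i \in A) == (hi i \in A)) f A +
    \sum_(A : {set 'I_n} | (lo i \in A) && (hi i \notin A)) (f A + f (swap_set i A)).
Proof.
rewrite big_split /= (bigID (fun A : {set 'I_n} => (lo i \in A) == (hi i \in A))) /=.
congr (_ + _); rewrite (bigID (fun A : {set 'I_n} => lo i \in A)) /=; congr (_ + _).
  by apply: eq_bigl => A; case: (_ \in A); case: (_ \in A).
rewrite (reindex_inj (inv_inj (swap_setK i))).
apply: eq_bigl => A; rewrite lo_swap hi_swap.
by case: (_ \in A); case: (_ \in A).
Qed.

Lemma msym_fixed (G : P) : dd i G = 0 -> msym (simple_tr i) G = G.
Proof. by move=> dG; rewrite msymE_dd dG mul0r subr0. Qed.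

Section Orbit.
Variables (c A : {set 'I_n}) (G : P).

Lemma dd_transfer_fixed (dG : dd i G = 0) :
  (lo i \in c) = (hi i \in c) -> (lo i \in A) = (hi i \in A) ->
  dd i (transfer c A * G) = 0.
Proof.
move=> ec eA; rewrite mulrC ddMl; last exact: msym_fixed.
rewrite (transferE i) ddMl; last exact: msym_other_factor.
have [/other_factor_eq0->|pq] := ltnP (rk A (lo i)) (rk c (lo i)).
  by rewrite mul0r mulr0.
by rewrite ec eA dd_local_fixed // !mulr0.
Qed.

Lemma dd_transfer_raise (dG : dd i G = 0) :
  lo i \in c -> hi i \notin c -> (lo i \in A) = (hi i \in A) ->
  y * (1 + b * x) * dd i (transfer c A * G) = transfer (swap_set i c) A * G.
Proof.
move=> loc hic eA; rewrite mulrC [transfer _ _ * G]mulrC ddMl; last exact: msym_fixed.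
rewrite !(transferE i) ddMl; last exact: msym_other_factor.
rewrite lo_swap hi_swap (@other_factor_swap _ _ c A A); last by left.
have [/other_factor_eq0->|pq] := ltnP (rk A (lo i)) (rk c (lo i)).
  by rewrite !mul0r !mulr0 mul0r.
rewrite rk_swap ?neq_ltn ?ltnSn // eA loc (negPf hic).
by rewrite -dd_local_raise //; ring.
Qed.

Lemma dd_transfer_orbit_fixed :
  (lo i \in c) = (hi i \in c) -> lo i \in A -> hi i \notin A ->
  dd i (transfer c A * G +
        transfer c (swap_set i A) * (y * (1 + b * x) * dd i G)) = 0.
Proof.
move=> ec loA hiA; rewrite !(transferE i) other_factor_swapr.
rewrite -2!(mulrA (other_factor _ _ _)) -mulrDr ddMl; last exact: msym_other_factor.
have [/other_factor_eq0->|pq] := ltnP (rk A (lo i)) (rk c (lo i)).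
  by rewrite mul0r.
rewrite lo_swap hi_swap rk_swap ?neq_ltn ?ltnSn // ec loA (negPf hiA).
by rewrite dd_local_orbit_fixed // mulr0.
Qed.

Lemma dd_transfer_orbit_raise :
  lo i \in c -> hi i \notin c -> lo i \in A -> hi i \notin A ->
  y * (1 + b * x) *
    dd i (transfer c A * G +
          transfer c (swap_set i A) * (y * (1 + b * x) * dd i G)) =
  transfer (swap_set i c) A * G +
  transfer (swap_set i c) (swap_set i A) * (y * (1 + b * x) * dd i G).
Proof.
move=> loc hic loA hiA; rewrite !(transferE i) other_factor_swapr.
rewrite (@other_factor_swap _ _ c A (swap_set i A)); last by right.
rewrite (@other_factor_swap _ _ c A A); last by left.
rewrite -4!(mulrA (other_factor _ _ _)) -2!mulrDr ddMl; last exact: msym_other_factor.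
have [/other_factor_eq0->|pq] := ltnP (rk A (lo i)) (rk c (lo i)).
  by rewrite !mul0r mulr0.
rewrite !lo_swap !hi_swap !rk_swap ?neq_ltn ?ltnSn //.
rewrite loA (negPf hiA) loc (negPf hic).
rewrite -dd_local_orbit_raise //.
by rewrite mulrCA.
Qed.

End Orbit.

Lemma dd_bool (m : bool) : dd i (m%:R : P) = 0.
Proof.
case: m; last exact: dd0.
by apply: dd_eq; rewrite msym1 mul0r; exact: subrr.
Qed.

(** Both claims need one joint induction: in the sum over [A], the sets fixed by the swap use the
    first claim for the shorter iterate, and the two-element orbits use the second. *)
Lemma transfer_iter_step r h c :
  ((lo i \in c) = (hi i \in c) -> dd i (transfer_iter r h c) = 0) /\
  (lo i \in c -> hi i \notin c ->
    y * (1 + b * x) * dd i (transfer_iter r h c) = transfer_iter r h (swap_set i c)).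
Proof.
elim: h c => [|h IH] c.
  split=> [_|loc hic]; first exact: dd_bool.
  rewrite [LHS](_ : _ = 0); last by rewrite dd_bool mulr0.
  (* The swapped set contains [hi i] but not [lo i], so it is not initial. *)
  rewrite [RHS]/(transfer_iter _ _ _); case: (boolP (_ == _)) => [/eqP e|_]; last by [].
  exfalso; have := lo_swap i c; have := hi_swap i c.
  by rewrite e !inE loc (negPf hic) /= => /ltnW ->.
split=> [c_eq|loc hic]; cbn [transfer_iter]; rewrite sum_swap_orbits ddD !dd_sum.
  rewrite -[RHS]addr0; congr (_ + _); apply: big1 => A.
    by move=> /eqP eA; apply: dd_transfer_fixed => //; apply: (IH A).1.
  (* The iterate at [swap_set i A] is written as the operator applied to the iterate at [A], the
     shape of the orbit identities. *)
  case/andP=> loA hiA; rewrite -(IH A).2 //.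
  exact: dd_transfer_orbit_fixed.
rewrite (sum_swap_orbits (fun A => transfer (swap_set i c) A * transfer_iter r h A)).
rewrite [LHS]mulrDr; congr (_ + _); rewrite [LHS]mulr_sumr; apply: eq_bigr => A.
  by move=> /eqP eA; apply: dd_transfer_raise => //; apply: (IH A).1.
case/andP=> loA hiA; rewrite -(IH A).2 //.
exact: dd_transfer_orbit_raise.
Qed.

End Step.

(** * Words, raising paths and the operator side *)

Section Words.
Variable n : nat.
Local Notation P := {mpoly {poly int}[n]}.
Implicit Types (c A : {set 'I_n}) (r h : nat) (ws : seq 'I_n.-1).

Definition word_set ws A : {set 'I_n} := foldr (@swap_set n) A ws.

Lemma mem_word_set ws A k : (word_perm ws k \in word_set ws A) = (k \in A).
Proof.
elim: ws k => [|i ws IH] k /=; first by rewrite perm1.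
by rewrite permM inE tpermK.
Qed.

(** A potential counting raising moves: [s_i] adds 1 if it moves [lo i] to a vacant [hi i],
    subtracts 1 in the opposite case, and otherwise leaves it unchanged. *)
Definition index_sum A : nat := (\sum_(k in A) k)%N.

Lemma index_sum_swap i A :
  (index_sum (swap_set i A) + (hi i \in A) = index_sum A + (lo i \in A))%N.
Proof.
have E B : index_sum B = ((lo i \in B) * lo i + ((hi i \in B) * hi i +
    \sum_(k | (k != lo i) && (k != hi i)) (k \in B) * k))%N.
  rewrite /index_sum big_mkcond (bigD1 (lo i)) // (bigD1 (hi i)) /=; last first.
    by rewrite eq_sym lo_neq_hi.
  congr (_ + (_ + _))%N; try by case: (_ \in _); rewrite ?mul1n.
  by apply: eq_bigr => k _; case: (_ \in _); rewrite ?mul1n.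
have -> : index_sum (swap_set i A) = ((hi i \in A) * lo i + ((lo i \in A) * hi i +
    \sum_(k | (k != lo i) && (k != hi i)) (k \in A) * k))%N.
  rewrite E lo_swap hi_swap; congr (_ + (_ + _))%N.
  by apply: eq_bigr => k /andP[kl kh]; rewrite mem_swap_other.
by rewrite E /=; case: (hi i \in A); case: (lo i \in A); lia.
Qed.

Lemma index_sum_word_le ws A : (index_sum (word_set ws A) <= index_sum A + size ws)%N.
Proof.
elim: ws => [|i ws IH] /=; first by rewrite addn0.
by have := index_sum_swap i (word_set ws A); case: (_ \in _); case: (_ \in _); lia.
Qed.

(** While [c] contains some [hi i] without [lo i], lowering it decreases the potential by one. When
    no such [i] is left, [c] is downward closed, hence initial. *)
Lemma init_word_exists c :
  exists2 ws, word_set ws (init_set n #|c|) = c &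
    (index_sum (init_set n #|c|) + size ws <= index_sum c)%N.
Proof.
have [m] := ubnP (index_sum c); elim: m c => // m IH c; rewrite ltnS => le_m.
case: (pickP (fun i : 'I_n.-1 => (hi i \in c) && (lo i \notin c))) => [i|down].
  case/andP=> hic loc; have := index_sum_swap i c; rewrite hic (negPf loc) => Ei.
  have [|ws Ews le_ws] := IH (swap_set i c); first by lia.
  rewrite card_swap in Ews le_ws.
  exists (i :: ws); first by rewrite /= Ews swap_setK.
  by rewrite addnS -[X in (_ <= X)%N]addn0 -Ei addn1 ltnS.
have c0 : c = init_set n #|c|.
  apply: down_closed_init => e f; case: f => f; elim: f => [|f IHf] fn /=.
    rewrite leqn0 => /eqP e0; suff -> : e = Ordinal fn by [].
    exact: val_inj.
  rewrite leq_eqVlt => /predU1P[ef|].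
    suff -> : e = Ordinal fn by [].
    exact: val_inj.
  rewrite ltnS => ef fc.
  have fn' : (f < n.-1)%N by lia.
  apply: (IHf (ltnW fn)) => //; have := down (Ordinal fn').
  have -> : hi (Ordinal fn') = Ordinal fn by apply: val_inj.
  have -> : lo (Ordinal fn') = Ordinal (ltnW fn) by apply: val_inj.
  by rewrite fc => /negbFE.
by exists [::]; rewrite -c0 //= addn0.
Qed.

(** Each letter raises the potential by at most one, so a total rise equal to the length makes every
    letter a raising move, covered by the second claim of [transfer_iter_step]. *)
Lemma transfer_iter_word r h ws :
  index_sum (word_set ws (init_set n r)) = (index_sum (init_set n r) + size ws)%N ->
  varpibar_word ws (transfer_iter r h (init_set n r)) =
  transfer_iter r h (word_set ws (init_set n r)).
Proof.
elim: ws => // i ws IH /= e_sum.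
have le_ws := index_sum_word_le ws (init_set n r).
have := index_sum_swap i (word_set ws (init_set n r)).
case lo_in: (lo i \in _); case hi_in: (hi i \in _); try lia.
move=> e_swap; rewrite IH; last by lia.
by rewrite varpibarE (transfer_iter_step i r h _).2 // hi_in.
Qed.

(** Any other set of size [r] has an element that is at least [r], hence fewer than [r] elements
    below [r], and the factor at [r.-1] vanishes. For the initial set the ranks agree, so no free
    entry is possible. *)
Lemma transfer_init r A : (r <= n)%N ->
  transfer (init_set n r) A = if A == init_set n r then \prod_(k in init_set n r) 'X_k else 0.
Proof.
move=> rn; have card_init : #|init_set n r| = r by rewrite -rk_max rk_init // (minn_idPl rn).
rewrite /transfer card_init; case: (A =P init_set n r) => [->|A_neq].
  rewrite card_init eqxx mul1r [RHS]big_mkcond; apply: eq_bigr => k _.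
  by rewrite /phi ltnn.
have [card_A|_] := eqVneq #|A| r; last by rewrite mul0r.
have [k kA le_rk] : exists2 k, k \in A & (r <= k)%N.
  apply/exists_inP; apply: contra_notT A_neq; rewrite negb_exists_in => /forall_inP A_lt.
  apply/eqP; rewrite eqEcard card_init card_A leqnn andbT.
  by apply/subsetP => k kA; rewrite inE ltnNge A_lt.
have lt_rk : (rk A r < r)%N.
  by rewrite -[X in (_ < X)%N]card_A -rk_max (leq_ltn_trans (rk_mono A le_rk)) ?rk_lt.
have r_gt0 := leq_ltn_trans (leq0n _) lt_rk.
have r'n : (r.-1 < n)%N by rewrite prednK.
have phi0 m : phi 'X_(Ordinal r'n) m (rk (init_set n r) r.-1.+1) (rk A r.-1.+1) = 0.
  by rewrite /phi prednK // rk_init // minnn lt_rk.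
rewrite (bigD1 (Ordinal r'n)) //= phi0 mul0r.
exact: mulr0.
Qed.

Lemma transfer_iter_init r h : (r <= n)%N ->
  transfer_iter r h (init_set n r) = \prod_(k in init_set n r) 'X_k ^+ h.
Proof.
move=> rn; elim: h => [|h IH].
  by rewrite /= eqxx big1.
rewrite [LHS]/= (bigD1 (init_set n r)) //= IH transfer_init // eqxx -[RHS]addr0; congr (_ + _).
  by rewrite -big_split; apply: eq_bigr => k _; rewrite exprS.
by apply: big1 => A /negPf A_neq; rewrite transfer_init // A_neq mul0r.
Qed.

Lemma perm_length_le ws : (perm_length (word_perm ws) <= size ws)%N.
Proof.
rewrite /perm_length; case: ex_minnP => m _; apply.
by apply/existsP; exists (in_tuple ws).
Qed.

Section Atom.
Variables (a : 'X_{1..n}) (a_rect : forall i j : 'I_n, a i <> 0%N -> a j <> 0%N -> a i = a j).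

Definition nonzero_cols : {set 'I_n} := [set k | a k != 0%N].

Lemma rect_height k : a k = ((k \in nonzero_cols) * height a)%N.
Proof.
rewrite inE; case: eqVneq => [->|/eqP a_k]; first by rewrite mul0n.
rewrite mul1n; apply/eqP; rewrite eqn_leq leq_bigmax /=; apply/bigmax_leqP => j _.
by case: (eqVneq (a j) 0%N) => [-> //|/eqP a_j]; rewrite (a_rect a_j a_k).
Qed.

Lemma lascoux_atom_transfer (lam : 'X_{1..n}) (w : 'S_n) ws :
  is_partition lam -> min_coset_rep lam w -> a = act_comp w lam -> reduced_word w ws ->
  lascoux_atom ws lam = transfer_iter #|nonzero_cols| (height a) nonzero_cols.
Proof.
move=> lam_part w_min a_eq [ws_w ws_size]; set r := #|nonzero_cols|.
have lamE k : lam k = a (w k) by rewrite a_eq mnmE permK.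
pose c0 := [set k | lam k != 0%N].
have memc0 k : (k \in c0) = (w k \in nonzero_cols) by rewrite !inE lamE.
have c0E : c0 = init_set n r.
  have -> : r = #|c0|.
    rewrite /r -(card_preimset nonzero_cols (@perm_inj _ w)); congr #|pred_of_set _|.
    by apply/setP => k; rewrite inE memc0.
  apply: down_closed_init => e f ef; rewrite !inE -!lt0n => /leq_trans; apply.
  exact: lam_part.
have supp_word us : (forall k, (word_perm us k \in nonzero_cols) = (k \in init_set n r)) ->
    word_set us (init_set n r) = nonzero_cols.
  move=> H; apply/setP => k; rewrite -(permKV (word_perm us) k) mem_word_set.
  by rewrite -H.
have ws_set : word_set ws (init_set n r) = nonzero_cols.
  by apply: supp_word => k; rewrite ws_w -memc0 c0E.
have rn : (r <= n)%N by rewrite -[X in (_ <= X)%N](card_ord n) max_card.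
rewrite /lascoux_atom; have -> : 'X_[lam] = transfer_iter r (height a) (init_set n r) :> P.
  rewrite transfer_iter_init // mpolyXE_id [RHS]big_mkcond; apply: eq_bigr => k _.
  rewrite lamE rect_height -memc0 c0E.
  by case: (_ \in _); rewrite ?mul1n ?mul0n ?expr0.
rewrite -[in RHS]ws_set; apply: transfer_iter_word.
apply/eqP; rewrite eqn_leq index_sum_word_le ws_set /=.
(* For the reverse bound [ws] is compared with a path [us] that only raises: its permutation lies in
   the coset of [w], so minimality of [w] bounds the size of [ws]. *)
have [us us_set us_le] := init_word_exists nonzero_cols.
apply: leq_trans us_le; rewrite leq_add2l ws_size.
apply: leq_trans (perm_length_le us).
(* This element fixes [lam]: both permutations carry the support of [lam] onto that of [a], and
   [lam] is constant on its support. *)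
have := w_min (word_perm us * w^-1)%g; rewrite mulgKV; apply.
apply/mnmP => j; rewrite mnmE !lamE !rect_height; congr (_ * _)%N; congr nat_of_bool.
rewrite -!memc0 c0E invMg invgK permM -(mem_word_set us) permKV us_set.
by rewrite -memc0 c0E.
Qed.

End Atom.
End Words.

(** * Expansion of the iterates into chains of anchor sets with free sets *)

Section Paths.
Variable n : nat.
Local Notation P := {mpoly {poly int}[n]}.
Local Notation b := (beta%:MP_[n] : P).
Implicit Types (c A B : {set 'I_n}) (r h : nat).

Lemma big_tuple_cons (T : finType) (R : nmodType) h (f : h.+1.-tuple T -> R) :
  \sum_t f t = \sum_x \sum_(t : h.-tuple T) f [tuple of x :: t].
Proof.
rewrite pair_big /= (reindex (fun p : T * h.-tuple T => [tuple of p.1 :: p.2])) //=.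
exists (fun t : h.+1.-tuple T => (thead t, [tuple of behead t])) => [[x t]|t] _.
  by congr pair; apply: val_inj.
by case/tupleP: t => x t; apply: val_inj.
Qed.

(* The y-th set of the chain c, t_0, t_1, ...; the last one is repeated forever. *)
Definition chain c (t : seq {set 'I_n}) y : {set 'I_n} := nth (last c t) (c :: t) y.

Lemma transfer_iter_chain r h c :
  transfer_iter r h c = \sum_(t : h.-tuple {set 'I_n} | last c t == init_set n r)
    \prod_(y < h) transfer (chain c t y) (chain c t y.+1).
Proof.
rewrite [RHS]big_mkcond; elim: h c => [|h IH] c /=.
  rewrite (big_pred1 [tuple]) => [|t]; last by symmetry; apply/eqP; case: t => [[]] // ?; apply: val_inj.
  by rewrite big_ord0 /=; case: (_ == _).
rewrite big_tuple_cons; apply: eq_bigr => A _; rewrite IH big_distrr /=.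
apply: eq_bigr => t _; case: (_ == _); last by rewrite mulr0.
by rewrite big_ord_recl.
Qed.

Definition row_le c A : bool :=
  (#|A| == #|c|) && [forall k : 'I_n, rk c k.+1 <= rk A k.+1]%N.

Definition free_set c A : {set 'I_n} :=
  [set k | (k \notin c) && (rk c k.+1 < rk A k.+1)%N].

Definition row_weight c (E : {set 'I_n}) : P :=
  (\prod_(k in c) 'X_k) * \prod_(k in E) (b * 'X_k).

Lemma row_weightE c (E : {set 'I_n}) :
  row_weight c E = b ^+ #|E| * \prod_k 'X_k ^+ ((k \in c) + (k \in E)).
Proof.
rewrite /row_weight [X in _ * X]big_split prodr_const mulrCA; congr (_ * _).
rewrite [X in X * _]big_mkcond [X in _ * X]big_mkcond -big_split; apply: eq_bigr => k _.
by case: (k \in c); case: (k \in E); rewrite /= ?expr0 ?expr1 ?mul1r ?mulr1.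
Qed.

Lemma transfer_free_sum c A :
  transfer c A = \sum_(E : {set 'I_n} | row_le c A && (E \subset free_set c A)) row_weight c E.
Proof.
rewrite /row_le /transfer; case: (_ == _); last by rewrite mul0r big_pred0.
rewrite mul1r; case: (boolP [forall k, _]) => [/forallP le_c|]; last first.
  rewrite negb_forall => /existsP[k]; rewrite -ltnNge => lt_k.
  by rewrite [RHS]big_pred0 // (bigD1 k) //= /phi lt_k mul0r.
(* [f] collects the anchors. [g] vanishes outside the free set, so expanding the product of the
   [g k + 1] over all subsets leaves only the admissible [E]. *)
pose f k : P := if k \in c then 'X_k else 1.
pose g k : P := if k \in free_set c A then b * 'X_k else 0.
transitivity ((\prod_k f k) * \prod_k (g k + 1)).
  rewrite -big_split; apply: eq_bigr => k _; rewrite /phi /f /g !inE ltnNge le_c /=.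
  case: (k \in c) => /=; first by rewrite add0r mulr1.
  rewrite mul1r; case: (_ < _)%N; last by rewrite add0r.
  exact: addrC.
rewrite bigA_distr big_distrr [RHS]big_mkcond; apply: eq_bigr => E _ /=.
rewrite -big_mkcond /row_weight; case: ifP => [/subsetP sub_E|/negbT/subsetPn[k kE kNU]].
  congr (_ * _); rewrite [RHS]big_mkcond; apply: eq_bigr => k _.
  by rewrite /g; case: ifP => // /sub_E ->.
by rewrite [X in _ * X](bigD1 k) //= kE /g (negPf kNU) mul0r mulr0.
Qed.

Definition chain_ok r h c (t : seq {set 'I_n}) (E : {ffun 'I_h -> {set 'I_n}}) : bool :=
  (last c t == init_set n r) &&
  [forall y : 'I_h, row_le (chain c t y) (chain c t y.+1) &&
     (E y \subset free_set (chain c t y) (chain c t y.+1))].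

Lemma transfer_iter_free_chain r h c :
  transfer_iter r h c =
  \sum_(p : h.-tuple {set 'I_n} * {ffun 'I_h -> {set 'I_n}} | chain_ok r c p.1 p.2)
    \prod_(y < h) row_weight (chain c p.1 y) (p.2 y).
Proof.
rewrite transfer_iter_chain.
rewrite -(pair_big_dep (fun t : h.-tuple {set 'I_n} => last c t == init_set n r)
  (fun t (E : {ffun 'I_h -> {set 'I_n}}) => [forall y : 'I_h, row_le (chain c t y) (chain c t y.+1) &&
     (E y \subset free_set (chain c t y) (chain c t y.+1))])
  (fun t (E : {ffun 'I_h -> {set 'I_n}}) => \prod_(y < h) row_weight (chain c t y) (E y))).
apply: eq_bigr => t _.
under [LHS]eq_bigr => y _ do rewrite transfer_free_sum.
rewrite bigA_distr_big_dep; apply: eq_bigl => E.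
by apply: eq_forallb => y; rewrite unfold_in.
Qed.

End Paths.

(** * The correspondence between tableaux and chains *)

Section Tableaux.
Local Open Scope nat_scope.
Variables (n : nat) (a : 'X_{1..n}).
Hypothesis a_rect : forall i j : 'I_n, a i <> 0 -> a j <> 0 -> a i = a j.
Local Notation c := (nonzero_cols a).
Local Notation h := (height a).
Local Notation r := #|c|.
Implicit Types (F : filling a) (A B : {set 'I_n}).

Lemma in_diagramE (bx : cell a) : in_diagram bx = (bx.1 \in c).
Proof. by rewrite /in_diagram (rect_height a_rect); case: (_ \in _); rewrite ?mul1n ?mul0n ?ltn_ord. Qed.

Lemma anchor_mem A : A != set0 -> exists2 x, x \in A & anchor A = x.
Proof.
case/set0Pn => x0 x0A; have [|x xA ex] := @eq_bigmax_cond _ (mem A) (fun e => e : nat).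
  by apply/card_gt0P; exists x0.
by exists x.
Qed.

Lemma le_anchor A x : x \in A -> x <= anchor A.
Proof. by move=> xA; apply: (@leq_bigmax_cond _ (mem A) (fun e => e : nat)). Qed.

(** The anchor as an element of ['I_n]; the default [bx.1] is taken only at an empty box. *)
Definition top_entry F (bx : cell a) : 'I_n :=
  odflt bx.1 [pick x in F bx | x == anchor (F bx) :> nat].

Lemma top_entryP F bx : F bx != set0 ->
  top_entry F bx \in F bx /\ anchor (F bx) = top_entry F bx.
Proof.
move/anchor_mem => [x xF ex]; rewrite /top_entry; case: pickP => [z /andP[zF /eqP ez]|/(_ x)] //=.
by rewrite xF ex eqxx.
Qed.

Lemma top_entry_eq F bx x : x \in F bx -> (forall z, z \in F bx -> z <= x) ->
  top_entry F bx = x.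
Proof.
move=> xF maxx; have [] := top_entryP (bx := bx) (F := F).
  by apply/set0Pn; exists x.
move=> tF te; apply: val_inj; apply/eqP; rewrite eqn_leq maxx //=.
by rewrite -[X in _ <= X]te le_anchor.
Qed.

Definition top_row F (y : 'I_h) : {set 'I_n} := [set top_entry F (j, y) | j in c].

(* Above the last row we put the smallest set of size r. *)
Definition anchor_set F (y : nat) : {set 'I_n} := oapp (top_row F) (init_set n r) (insub y).

Definition free_row F (y : 'I_h) : {set 'I_n} := (\bigcup_i F (i, y)) :\: top_row F y.

(** The tuple starts with row 1, since in a tableau the anchors of row 0 form [c], and runs up to
    the initial set above the top row. *)
Definition to_chain F : h.-tuple {set 'I_n} * {ffun 'I_h -> {set 'I_n}} :=
  ([tuple anchor_set F y.+1 | y < h], [ffun y => free_row F y]).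

(* An entry x of row y goes to the column whose rank in c is the number of
   anchors of row y smaller than x. *)
Definition of_chain (p : h.-tuple {set 'I_n} * {ffun 'I_h -> {set 'I_n}}) : filling a :=
  [ffun bx : cell a => if bx.1 \in c then
    [set x in chain c p.1 bx.2 :|: p.2 bx.2 | rk (chain c p.1 bx.2) x == rk c bx.1]
  else set0].

Lemma anchor_set_ord F (y : 'I_h) : anchor_set F y = top_row F y.
Proof. by rewrite /anchor_set valK. Qed.

Lemma anchor_set_top F y : h <= y -> anchor_set F y = init_set n r.
Proof. by move=> hy; rewrite /anchor_set insubN // -leqNgt. Qed.

Lemma card_init_set : #|init_set n r| = r.
Proof. by rewrite -rk_max rk_init //; apply/minn_idPl; rewrite -[X in _ <= X](card_ord n) max_card. Qed.

(** * From a tableau to a chain *)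

Section FromSky.
Variable F : filling a.
Hypothesis F_sky : F \in Sky a.
Local Notation top i y := (top_entry F (i, y)).

Lemma sky_parts :
  [/\ skyS0 F, skyS1 F, skyS2 F & [/\ skyS3 F, skyS4 F & skyS5 F]].
Proof. by move: F_sky; rewrite inE => /and5P[-> -> -> -> /andP[]]. Qed.

Lemma sky_neq0 bx : (F bx != set0) = (bx.1 \in c).
Proof. by case: sky_parts => /forallP/(_ bx)/eqP -> _ _ _; rewrite in_diagramE. Qed.

Lemma sky_mem_support i y x : x \in F (i, y) -> i \in c.
Proof. by move=> xF; rewrite -(sky_neq0 (i, y)); apply/set0Pn; exists x. Qed.

Lemma sky_inj i j y x : x \in F (i, y) -> x \in F (j, y) -> i = j.
Proof.
case: sky_parts => _ /forallP/(_ y)/forallP/(_ i)/forallP/(_ j) S1 _ _ xi xj.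
apply/eqP; apply: contraT => ij; move: S1; rewrite ij /= => /pred0P/(_ x) /=.
by rewrite xi xj.
Qed.

Lemma sky_le i (y y' : 'I_h) x z : y = y'.+1 :> nat ->
  x \in F (i, y) -> z \in F (i, y') -> x <= z.
Proof.
case: sky_parts => _ _ /forallP/(_ i)/forallP/(_ y)/forallP/(_ y') S2 _ yy xF zF.
move: S2; rewrite yy eqxx in_diagramE (sky_mem_support xF) /=.
by move=> /forall_inP/(_ x xF)/forall_inP/(_ z zF).
Qed.

Lemma top_mem i y : i \in c -> top i y \in F (i, y).
Proof. by move=> ic; case: (@top_entryP F (i, y)); rewrite ?sky_neq0. Qed.

Lemma anchor_top i y : i \in c -> anchor (F (i, y)) = top i y.
Proof. by move=> ic; case: (@top_entryP F (i, y)); rewrite ?sky_neq0. Qed.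

Lemma le_top i y x : x \in F (i, y) -> x <= top i y.
Proof. by move=> xF; rewrite -anchor_top ?le_anchor // (sky_mem_support xF). Qed.

(** Induction on the row, starting from [skyS5]. For [j < i] the other alternative in [skyS3] puts
    the anchor of [(i, y')] below that of [(j, y)]; but the latter is at most that of [(j, y')] by
    [skyS2], which by induction is below that of [(i, y')]. *)
Lemma top_mono y : {in c &, {mono (fun i => top i y) : i j / i < j}}.
Proof.
have mono j i : j \in c -> i \in c -> j < i -> top j y < top i y.
  case: y => y; elim: y => [|y IH] yh jc ic ji.
    case: sky_parts => _ _ _ [_ _ /forallP S5].
    have top0 k : k \in c -> top k (Ordinal yh) = k :> nat.
      move=> kc; rewrite -anchor_top //.
      by move/forallP/(_ (Ordinal yh)): (S5 k); rewrite in_diagramE /= kc => /eqP.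
    by rewrite !top0.
  pose y' := Ordinal (ltnW yh); pose y1 := Ordinal yh.
  case: sky_parts => _ _ _ [/forallP/(_ j)/forallP/(_ i)/forallP/(_ y1)/forallP/(_ y') S3 _ _].
  move: S3; rewrite ji eqxx /= => /andP[S3 _]; move: S3.
  rewrite (rect_height a_rect i) (rect_height a_rect j) ic jc leqnn !in_diagramE ic jc /=.
  rewrite /triple_ok !anchor_top // => /orP[//|lt_ij].
  have le_j : top j y1 <= top j y' by apply: (@sky_le j y1 y'); rewrite ?top_mem.
  by have := IH (ltnW yh) jc ic ji; rewrite ltnNge (leq_trans (ltnW lt_ij) le_j).
move=> i j ic jc; apply/idP/idP; last exact: mono.
apply: contraTT; rewrite -!leqNgt leq_eqVlt => /predU1P[/val_inj -> //|ji].
exact: ltnW (mono _ _ jc ic ji).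
Qed.

Lemma top_inj y : {in c &, injective (fun i => top i y)}.
Proof.
move=> i j ic jc /(congr1 val) /= e; case: (ltngtP i j) => [||/ord_inj //].
  by rewrite -(top_mono y ic jc) e ltnn.
by rewrite -(top_mono y jc ic) e ltnn.
Qed.

Lemma rk_top_row y k : rk (top_row F y) k = #|[set j in c | top j y < k]|.
Proof.
rewrite /rk -[RHS](card_in_imset (f := fun j => top j y)); last first.
  by move=> i j /setIdP[ic _] /setIdP[jc _]; apply: top_inj.
apply: eq_card => e; apply/setIdP/imsetP => [[/imsetP[j jc ->] lt_k]|[j]].
  by exists j => //; apply/setIdP.
by case/setIdP=> jc lt_k ->; split => //; apply: imset_f.
Qed.

Lemma card_top_row y : #|top_row F y| = r.
Proof. exact: card_in_imset (@top_inj y). Qed.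

(** For anchors this is [top_mono]. A free [x] below the anchor of a column [j < i] could be moved
    to that column without violating [skyS2], against [skyS4]. *)
Lemma top_lt i j y x : x \in F (i, y) -> j \in c -> (top j y < x) = (j < i).
Proof.
move=> xF jc; have ic := sky_mem_support xF.
have [ij|ji] := leqP i j.
  apply/negbTE; rewrite -leqNgt (leq_trans (le_top xF)) // leqNgt top_mono //.
  by rewrite -leqNgt.
have [->|x_top] := eqVneq x (top i y); first by rewrite top_mono.
have x_neq : x != top j y.
  apply: contraTneq ji => ex; rewrite (@sky_inj j i y x) ?ltnn //.
  by rewrite ex top_mem.
case: sky_parts => _ _ _ [_ /forallP/(_ i)/forallP/(_ y)/forall_inP/(_ x xF) S4 _].
move: S4; rewrite anchor_top // val_eqE x_top => /forallP/(_ j); rewrite ji /=.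
rewrite /can_be_free in_diagramE jc anchor_top //=.
case: (ltnP (top j y) x) => // le_x.
have lt_x : x < top j y by rewrite ltn_neqAle val_eqE x_neq.
rewrite lt_x /=; case/negP; apply/forallP => k; apply/forallP => z; apply/forallP => z'.
apply/implyP => /andP[/eqP zz _]; apply/forall_inP => u; rewrite ffunE => uF.
apply/forall_inP => v; rewrite ffunE => vF.
have z_neq : z' == z = false by rewrite -val_eqE /= zz ltn_eqF.
case: eqP uF vF => [[kj zy]|_] uF; rewrite xpair_eqE.
  (* If [x] enters the upper box of the pair, it is below the anchor there, which is at most every
     entry underneath. *)
  rewrite -zy z_neq andbF => vF; case/setU1P: uF => [->|uF]; last exact: sky_le zz uF vF.
  by rewrite (leq_trans (ltnW lt_x)) // -zy (@sky_le k z z') // kj top_mem.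
case: andP => [[/eqP kj /eqP zy]|_ vF]; last exact: sky_le zz uF vF.
case/setU1P => [->|vF]; last exact: sky_le zz uF vF.
(* If [x] enters the lower box, an entry above it is at most the anchor of column [j] in row [z],
   hence at most that of column [i], which is at most [x]. *)
rewrite zy in zz; rewrite (leq_trans (le_top uF)) // kj (leq_trans _ (sky_le zz (top_mem z ic) xF)) //.
by rewrite ltnW ?top_mono.
Qed.

Lemma rk_entry i y x : x \in F (i, y) -> rk (top_row F y) x = rk c i.
Proof.
move=> xF; rewrite rk_top_row /rk; apply: eq_card => j; apply/setIdP/setIdP => -[jc].
  by rewrite (top_lt xF).
by rewrite -(top_lt xF).
Qed.

(** In the row above, the anchors of column [i] and of the [rk c i] nonempty columns to its left are
    all at most [x]. *)
Lemma rk_entry_above i y x : x \in F (i, y) -> rk c i < rk (anchor_set F y.+1) x.+1.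
Proof.
move=> xF; have ic := sky_mem_support xF.
have [yh|hy] := ltnP y.+1 h; last first.
  (* Above the top row the rank is [minn r x.+1], so both [rk c i < r] and [rk c i <= x] are
     needed. *)
  rewrite anchor_set_top // rk_init // leq_min -[X in (_ < X) && _]rk_max rk_lt //=.
  by rewrite ltnS -(rk_entry xF) rk_le_id.
rewrite (anchor_set_ord F (Ordinal yh)) rk_top_row -addn1 -[X in _ + X](_ : (i \in c) = 1 :> nat).
  rewrite -rkS; apply/subset_leq_card/subsetP => j /setIdP[jc ji]; apply/setIdP; split=> //.
  rewrite ltnS in ji; rewrite ltnS.
  have le_x : top i (Ordinal yh) <= x by exact: (@sky_le i (Ordinal yh) y _ _ erefl (top_mem _ ic) xF).
  apply: leq_trans le_x; move: ji; rewrite leq_eqVlt => /predU1P[/val_inj -> //|ji].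
  by rewrite ltnW ?top_mono.
by rewrite ic.
Qed.

Lemma row_le_anchor_set (y : 'I_h) : row_le (anchor_set F y) (anchor_set F y.+1).
Proof.
have [yh|hy] := ltnP y.+1 h; last first.
  rewrite anchor_set_ord anchor_set_top // /row_le card_init_set card_top_row eqxx /=.
  apply/forallP => k; rewrite rk_init // leq_min rk_le_id andbT.
  by rewrite -[X in _ <= X](card_top_row y) rk_le_card.
rewrite anchor_set_ord (anchor_set_ord F (Ordinal yh)) /row_le !card_top_row eqxx /=.
apply/forallP => k; rewrite !rk_top_row; apply/subset_leq_card/subsetP => j.
case/setIdP => jc lt_k; apply/setIdP; split => //; apply: leq_ltn_trans lt_k.
by apply: (@sky_le j (Ordinal yh) y); rewrite ?top_mem.
Qed.

Lemma free_row_sub (y : 'I_h) : free_row F y \subset free_set (anchor_set F y) (anchor_set F y.+1).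
Proof.
apply/subsetP => x /setDP[/bigcupP[i _ xF] xNtop]; rewrite inE anchor_set_ord xNtop /=.
by rewrite rkS (negPf xNtop) addn0 (rk_entry xF) rk_entry_above.
Qed.

Lemma anchor_set0 : anchor_set F 0 = c.
Proof.
(* Without rows there are no nonempty columns, and the initial set above the diagram is empty. *)
have [h0|h_gt0] := leqP h 0.
  rewrite anchor_set_top //; apply/setP => k.
  have c0 : c = set0.
    apply/setP => j; rewrite !inE; apply/negbTE; rewrite negbK -leqn0 (leq_trans _ h0) //.
    exact: leq_bigmax.
  by rewrite c0 cards0 !inE.
rewrite (anchor_set_ord F (Ordinal h_gt0)); apply/setP => x.
case: sky_parts => _ _ _ [_ _ /forallP S5].
have top0 k : k \in c -> top k (Ordinal h_gt0) = k.
  move=> kc; apply: val_inj; rewrite /= -anchor_top //.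
  by move/forallP/(_ (Ordinal h_gt0)): (S5 k); rewrite in_diagramE /= kc => /eqP.
apply/imsetP/idP => [[j jc ->]|xc]; first by rewrite top0.
by exists x; rewrite ?top0.
Qed.

Lemma chain_to_chain y : y <= h -> chain c (to_chain F).1 y = anchor_set F y.
Proof.
case: y => [|y] yh; first by rewrite anchor_set0.
by rewrite /chain /= (nth_mktuple _ _ (Ordinal yh)).
Qed.

Lemma to_chain_ok : chain_ok #|c| c (to_chain F).1 (to_chain F).2.
Proof.
apply/andP; split.
  rewrite -[X in X == _](_ : chain c (to_chain F).1 h = _).
    by rewrite chain_to_chain // anchor_set_top.
  by rewrite /chain -[X in nth _ _ X](size_tuple (to_chain F).1) nth_last.
apply/forallP => y; rewrite !chain_to_chain // 1?ltnW // row_le_anchor_set ffunE.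
exact: free_row_sub.
Qed.

Lemma to_chainK : of_chain (to_chain F) = F.
Proof.
apply/ffunP => -[i y]; rewrite !ffunE /=; case: (boolP (i \in c)) => ic; last first.
  by symmetry; apply/eqP; move: ic; apply: contraNT; rewrite sky_neq0.
rewrite chain_to_chain 1?ltnW // anchor_set_ord; apply/setP => x; rewrite inE.
apply/andP/idP => [[xU /eqP rk_x]|xF].
  have [j xF] : exists j, x \in F (j, y).
    case/setUP: xU => [/imsetP[j jc ->]|]; first by exists j; apply: top_mem.
    by case/setDP => /bigcupP[j _ xF] _; exists j.
  rewrite -(@rk_inj _ c j i) ?(sky_mem_support xF) //.
  by rewrite -(rk_entry xF).
rewrite (rk_entry xF) eqxx inE in_setD andbC; split => //.
case: (x \in top_row F y) => //=; rewrite andbT; apply/bigcupP; by exists i.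
Qed.

End FromSky.

(** * From a chain to a tableau *)

Section FromChain.
Variable p : h.-tuple {set 'I_n} * {ffun 'I_h -> {set 'I_n}}.
Hypothesis p_ok : chain_ok r c p.1 p.2.
Local Notation al y := (chain c p.1 y).
Local Notation F := (of_chain p).

Lemma chain_last : al h = init_set n r.
Proof.
case/andP: p_ok => /eqP e _; rewrite -[RHS]e.
by rewrite /chain -[X in nth _ _ X](size_tuple p.1) nth_last.
Qed.

Lemma chain_row_le (y : 'I_h) : row_le (al y) (al y.+1).
Proof. by case/andP: p_ok => _ /forallP/(_ y)/andP[]. Qed.

Lemma chain_free (y : 'I_h) : p.2 y \subset free_set (al y) (al y.+1).
Proof. by case/andP: p_ok => _ /forallP/(_ y)/andP[]. Qed.

Lemma card_chain y : y <= h -> #|al y| = r.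
Proof.
elim: y => [|y IH] yh //; have /andP[/eqP e _] := chain_row_le (Ordinal yh).
by rewrite -IH ?(ltnW yh).
Qed.

Lemma mem_of_chain i (y : 'I_h) x :
  (x \in F (i, y)) = [&& i \in c, x \in al y :|: p.2 y & rk (al y) x == rk c i].
Proof. by rewrite ffunE /=; case: (_ \in c); rewrite ?inE. Qed.

(** An anchor raises the rank of its own row at [x.+1]; a free entry has strict inequality by
    [free_set]. The existence of a column for [x] and [skyS2] both rest on this bound. *)
Lemma rk_row_above (y : 'I_h) x : x \in al y :|: p.2 y -> rk (al y) x < rk (al y.+1) x.+1.
Proof.
case/setUP => [xal|/(subsetP (chain_free y))].
  have /andP[_ /forallP/(_ x)] := chain_row_le y; apply: leq_trans.
  exact: rk_lt.
by rewrite inE => /andP[_]; apply: leq_ltn_trans; apply: rk_mono.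
Qed.

Lemma free_notin_chain (y : 'I_h) x : x \in p.2 y -> x \notin al y.
Proof. by move/(subsetP (chain_free y)); rewrite inE => /andP[]. Qed.

Lemma row_column (y : 'I_h) x : x \in al y :|: p.2 y -> exists i, x \in F (i, y).
Proof.
move=> xU; have [|i ic rk_i] := @rk_surj _ c (rk (al y) x).
  by rewrite (leq_trans (rk_row_above xU)) // -(@card_chain y.+1) // rk_le_card.
by exists i; rewrite mem_of_chain ic xU rk_i eqxx.
Qed.

(** The rank increases right after each anchor, so an anchor is the largest entry of its rank. *)
Lemma of_chain_top i (y : 'I_h) : i \in c ->
  [/\ top_entry F (i, y) \in al y, rk (al y) (top_entry F (i, y)) = rk c i
    & anchor (F (i, y)) = top_entry F (i, y)].
Proof.
move=> ic; have [|e eal rk_e] := @rk_surj _ (al y) (rk c i).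
  by rewrite card_chain ?(ltnW (ltn_ord y)) // -rk_max rk_lt.
have eF : e \in F (i, y) by rewrite mem_of_chain ic inE eal rk_e eqxx.
rewrite (@top_entry_eq F (i, y) e) //; last first.
  move=> z; rewrite mem_of_chain => /and3P[_ _ /eqP rk_z].
  by rewrite leqNgt; apply/negP => /(rk_lt eal); rewrite rk_z rk_e ltnn.
split=> //; have [] := @top_entryP F (i, y); first by apply/set0Pn; exists e.
rewrite (@top_entry_eq F (i, y) e) // => z; rewrite mem_of_chain => /and3P[_ _ /eqP rk_z].
by rewrite leqNgt; apply/negP => /(rk_lt eal); rewrite rk_z rk_e ltnn.
Qed.

Lemma of_chain_top_lt i j (y : 'I_h) x : j \in c -> x \in F (i, y) -> j < i ->
  top_entry F (j, y) < x.
Proof.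
move=> jc; rewrite mem_of_chain => /and3P[ic _ /eqP rk_x] ji.
have [_ rk_j _] := of_chain_top y jc.
rewrite ltnNge; apply/negP => /(rk_mono (al y)); rewrite rk_j rk_x leqNgt.
by rewrite rk_lt.
Qed.

Lemma of_chain_neq0 bx : (F bx != set0) = (bx.1 \in c).
Proof.
case: bx => i y /=; apply/idP/idP => [/set0Pn[x]|ic]; first by rewrite mem_of_chain => /andP[].
have [eal rk_e _] := of_chain_top y ic.
by apply/set0Pn; exists (top_entry F (i, y)); rewrite mem_of_chain ic inE eal rk_e eqxx.
Qed.

Lemma of_chain_le i (y y' : 'I_h) x z : y = y'.+1 :> nat ->
  x \in F (i, y) -> z \in F (i, y') -> x <= z.
Proof.
move=> yy; rewrite !mem_of_chain => /and3P[ic _ /eqP rk_x] /and3P[_ zU /eqP rk_z].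
rewrite leqNgt; apply/negP => /(rk_mono (al y)); apply/negP; rewrite -ltnNge rk_x -rk_z yy.
exact: rk_row_above.
Qed.

(** Every entry exceeds the anchors to its left in its row. This gives the first alternative of
    [skyS3] and leaves no box further left for a free entry; triples with [a i < a j] do not occur,
    both columns having the same height. *)
Lemma of_chain_sky : F \in Sky a.
Proof.
rewrite inE; apply/and5P; split; last (apply/andP; split).
- by apply/forallP => bx; rewrite of_chain_neq0 in_diagramE.
- apply/forallP => y; apply/forallP => i; apply/forallP => j; apply/implyP.
  apply: contraNT => /pred0Pn[x /andP[/= xi xj]]; move: xi xj; rewrite !mem_of_chain.
  by case/and3P => ic _ /eqP rk_i /and3P[jc _ /eqP rk_j]; apply/eqP/(rk_inj ic jc); rewrite -rk_i.
- apply/forallP => i; apply/forallP => y; apply/forallP => y'.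
  apply/implyP => /andP[/eqP yy _]; apply/forall_inP => x xF; apply/forall_inP => z zF.
  exact: of_chain_le yy xF zF.
- apply/forallP => j; apply/forallP => i; apply/forallP => y; apply/forallP => y'.
  apply/implyP => /andP[ji _]; rewrite !in_diagramE /=; apply/andP; split; apply/implyP => /and3P[lt_a jc ic].
    have [_ _ anc_j] := of_chain_top y jc; have [eal rk_i anc_i] := of_chain_top y ic.
    rewrite /triple_ok anc_j anc_i (@of_chain_top_lt i j y) //.
    by rewrite mem_of_chain ic inE eal rk_i eqxx.
  by move: lt_a; rewrite (rect_height a_rect i) (rect_height a_rect j) ic jc ltnn.
- apply/forallP => i; apply/forallP => y; apply/forall_inP => x xF; apply/implyP => _.
  apply/forallP => j; apply/implyP => ji; apply/negP; rewrite /can_be_free in_diagramE /=.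
  case/and3P => jc; have [_ _ ->] := of_chain_top y jc.
  by rewrite ltnNge ltnW // (of_chain_top_lt jc xF ji).
- apply/forallP => i; apply/forallP => y; apply/implyP; rewrite in_diagramE /= => /andP[/eqP y0 ic].
  have [] := of_chain_top y ic; rewrite y0 /= => ec rk_e ->; apply/eqP; congr val.
  exact: rk_inj ec ic rk_e.
Qed.

Lemma top_row_of_chain (y : 'I_h) : top_row F y = al y.
Proof.
apply/setP => x; apply/imsetP/idP => [[j jc ->]|xal]; first by case: (of_chain_top y jc).
have [i] : exists i, x \in F (i, y) by apply: row_column; rewrite inE xal.
rewrite mem_of_chain => /and3P[ic _ /eqP rk_x]; exists i => //.
have [eal rk_e _] := of_chain_top y ic.
by apply: (rk_inj xal eal); rewrite rk_x rk_e.
Qed.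

Lemma of_chainK : to_chain F = p.
Proof.
have tupE : (to_chain F).1 = p.1.
  apply: eq_from_tnth => y; rewrite tnth_mktuple.
  rewrite (tnth_nth (last c p.1)) -[RHS]/(al y.+1).
  have [yh|hy] := ltnP y.+1 h.
    by rewrite (anchor_set_ord F (Ordinal yh)) top_row_of_chain.
  by rewrite anchor_set_top // -chain_last; congr chain; apply/eqP; rewrite eqn_leq hy ltn_ord.
have freeE : (to_chain F).2 = p.2.
  apply/ffunP => y; rewrite ffunE; apply/setP => x; rewrite in_setD top_row_of_chain.
  apply/andP/idP => [[xNal /bigcupP[i _]]|xE].
    by rewrite mem_of_chain in_setU (negPf xNal) => /and3P[].
  split; first exact: free_notin_chain.
  have [i xF] : exists i, x \in F (i, y) by apply: row_column; rewrite inE xE orbT.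
  by apply/bigcupP; exists i.
by rewrite [RHS]surjective_pairing -tupE -freeE.
Qed.

(** The rank of [x] fixes its column, and no anchor is free, so both sides are at most 1. *)
Lemma sum_column (y : 'I_h) x : \sum_i (x \in F (i, y)) = (x \in al y) + (x \in p.2 y).
Proof.
have [xU|xNU] := boolP (x \in al y :|: p.2 y).
  have [i xF] := row_column xU; rewrite (bigD1 i) //= xF big1 => [|j ji].
    move: xU; rewrite inE; case: (boolP (x \in p.2 y)) => [/free_notin_chain/negPf ->|_] //.
    by rewrite orbF => ->.
  apply/eqP; rewrite eqb0; apply: contra ji => xFj; move: xF xFj; rewrite !mem_of_chain.
  by case/and3P => ic _ /eqP rk_i /and3P[jc _ /eqP rk_j]; apply/eqP/(rk_inj jc ic); rewrite -rk_i.
rewrite big1 => [|i _]; last by rewrite mem_of_chain (negPf xNU) andbF.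
by move: xNU; rewrite inE => /norP[/negPf -> /negPf ->].
Qed.

Lemma sky_content_of_chain k :
  sky_content F k = \sum_(y < h) ((k \in al y) + (k \in p.2 y)).
Proof.
rewrite mnmE -sum1_card big_mkcond /=.
rewrite (eq_bigr (fun bx : cell a => (k \in F (bx.1, bx.2)) : nat)) => [|[i y] _]; last first.
  by rewrite inE; case: (_ \in _).
rewrite -(pair_bigA _ (fun i y => (k \in F (i, y)) : nat)) exchange_big /=.
by apply: eq_bigr => y _; rewrite sum_column.
Qed.

Lemma sky_excess_of_chain : sky_excess F = \sum_(y < h) #|p.2 y|.
Proof.
have card_sum (A : {set 'I_n}) : #|A| = \sum_k (k \in A).
  by rewrite -sum1_card big_mkcond /=; apply: eq_bigr => k _; case: (_ \in _).
have entries : \sum_(bx : cell a) #|F bx| = \sum_(y < h) (r + #|p.2 y|).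
  under eq_bigr => bx _ do rewrite card_sum.
  rewrite (eq_bigr (fun bx : cell a => \sum_k (k \in F (bx.1, bx.2)))) => [|[] //].
  rewrite -(pair_bigA _ (fun i y => \sum_k (k \in F (i, y)))) exchange_big /=.
  apply: eq_bigr => y _; rewrite exchange_big /=.
  under eq_bigr => k _ do rewrite sum_column.
  by rewrite big_split /= -!card_sum card_chain // ltnW.
have diagram : \sum_(bx : cell a | in_diagram bx) 1 = \sum_(y < h) r.
  rewrite (eq_bigl (fun bx : cell a => (bx.1 \in c) && true)) => [|bx]; last first.
    by rewrite in_diagramE andbT.
  rewrite -(pair_big (mem c) xpredT (fun _ _ => 1)) exchange_big /=.
  by apply: eq_bigr => y _; rewrite sum1_card.
(* Adding one for each box, [r] in every row, removes the truncated predecessor from the excess. *)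
apply/eqP; rewrite -(eqn_add2l (\sum_(y < h) r)) -big_split -entries -diagram -big_split /=.
rewrite [X in _ == X](bigID (@in_diagram n a)) /= [X in _ == _ + X]big1 ?addn0.
  apply/eqP; apply: eq_bigr => bx; rewrite in_diagramE -of_chain_neq0 -card_gt0 => F_gt0.
  by rewrite add1n prednK.
by move=> bx; rewrite in_diagramE -of_chain_neq0 negbK => /eqP ->; rewrite cards0.
Qed.

Lemma wt_beta_of_chain :
  wt_beta F = (\prod_(y < h) row_weight (al y) (p.2 y))%R.
Proof.
under [RHS]eq_bigr => y _ do rewrite row_weightE.
rewrite big_split exchange_big /= prodrXr -sky_excess_of_chain.
rewrite /wt_beta mpolyXE_id -mul_mpolyC rmorphXn; congr (_ * _)%R.
by apply: eq_bigr => k _; rewrite sky_content_of_chain prodrXr.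
Qed.

End FromChain.

Lemma sum_sky_transfer :
  (\sum_(S in Sky a) wt_beta S = transfer_iter r h c)%R.
Proof.
rewrite transfer_iter_free_chain (reindex_onto of_chain to_chain to_chainK).
apply: eq_big => [p|p /andP[F_sky /eqP toK]].
  apply/andP/idP => [[F_sky /eqP <-]|p_ok]; first exact: to_chain_ok.
  by rewrite of_chain_sky // of_chainK.
by apply: wt_beta_of_chain; rewrite -toK; apply: to_chain_ok.
Qed.

End Tableaux.

Theorem theorem5p3 (n : nat) (a lam : 'X_{1..n}) (w : 'S_n) (ws : seq 'I_n.-1)
    (a_rect : forall i j : 'I_n, a i <> 0%N -> a j <> 0%N -> a i = a j)
    (lam_part : is_partition lam)
    (w_min : min_coset_rep lam w)
    (a_eq : a = act_comp w lam)
    (ws_red : reduced_word w ws) :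
  lascoux_atom ws lam = \sum_(S in Sky a) wt_beta S.
Proof.
by rewrite sum_sky_transfer //; apply: lascoux_atom_transfer ws_red.
Qed.
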